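(* Let $I=\{1,\dots,n\}$ and $J=\{1,\dots,m\}$ with $n,m\ge 1$, let $A=(a_{ij})_{n\times m}$ be a matrix with all $a_{ij}\in[0,1]$, and let $x=(x_1,\dots,x_n)\in[0,1]^n$. Fix $j\in J$. Suppose that the following two conditions hold: (a) for each $j'\in J$ there exists $i\in I$ such that $\max(x_i,a_{ij'})<1$; (b) $\min(x_i,a_{ij})=0$ for all $i\in I$. Then for every t-norm $T$ and every t-conorm $S$, $$\mathop{S}_{i=1}^{n}\{T(x_i,a_{ij})\}<\max_{i=1}^{n}\{1-|x_i-a_{ij}|\}.$$
   Context: A t-norm is a function $T:[0,1]^2\to[0,1]$ that is commutative, associative, non-decreasing in each argument, and satisfies $T(a,1)=a$ for all $a\in[0,1]$. A t-conorm is a function $S:[0,1]^2\to[0,1]$ that is commutative, associative, non-decreasing in each argument, and satisfies $S(a,0)=a$ for all $a\in[0,1]$. For a t-conorm $S$ and $c_1,\dots,c_n\in[0,1]$, $\mathop{S}_{i=1}^{n}\{c_i\}$ denotes the $n$-ary extension of $S$ by associativity: $\mathop{S}_{i=1}^{1}\{c_i\}=c_1$ and $\mathop{S}_{i=1}^{n}\{c_i\}=S\big(\mathop{S}_{i=1}^{n-1}\{c_i\},c_n\big)$. *)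

(* Defs.v *)
From mathcomp Require Import all_boot all_order all_algebra.
From mathcomp Require Import interval_inference reals.

Set Implicit Arguments.
Unset Strict Implicit.
Unset Printing Implicit Defensive.

Import Order.TTheory GRing.Theory Num.Theory.
Local Open Scope ring_scope.

Record is_tnorm (R : realType) (T : {i01 R} -> {i01 R} -> {i01 R}) : Prop :=
  IsTnorm {
    tnormC : commutative T;
    tnormA : associative T;
    tnorm_homol : forall b, {homo T^~ b : a a' / a <= a'};
    tnorm_homor : forall a, {homo T a : b b' / b <= b'};
    tnorm1 : right_id (1%:i01 : {i01 R}) T
  }.

Record is_tconorm (R : realType) (S : {i01 R} -> {i01 R} -> {i01 R}) : Prop :=
  IsTconorm {
    tconormC : commutative S;
    tconormA : associative S;
    tconorm_homol : forall b, {homo S^~ b : a a' / a <= a'};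
    tconorm_homor : forall a, {homo S a : b b' / b <= b'};
    tconorm0 : right_id (0%:i01 : {i01 R}) S
  }.

(* The left-nested S (... S (S c_1 c_2) ...) c_n; the value 0 for n = 0 is a
   convention, see nary_ext1 and nary_extS for the defining recursion. *)
Definition nary_ext (R : realType) (S : {i01 R} -> {i01 R} -> {i01 R})
    (n : nat) (c : 'I_n -> {i01 R}) : {i01 R} :=
  if [seq c i | i <- enum 'I_n] is c1 :: cs then foldl S c1 cs else 0%:i01.

Lemma nary_ext1 (R : realType) (S : {i01 R} -> {i01 R} -> {i01 R})
  (c : 'I_1 -> {i01 R}) : nary_ext S c = c ord0.
Proof. by rewrite /nary_ext enum_ordSl enum_ord0. Qed.

Lemma nary_extS (R : realType) (S : {i01 R} -> {i01 R} -> {i01 R}) (n : nat)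
    (c : 'I_n.+2 -> {i01 R}) :
  nary_ext S c
  = S (nary_ext S (fun i : 'I_n.+1 => c (widen_ord (leqnSn n.+1) i)))
      (c ord_max).
Proof.
rewrite /nary_ext enum_ordSr map_rcons -map_comp.
rewrite (eq_map (_ : _ \o _ =1
  (fun i : 'I_n.+1 => c (widen_ord (leqnSn n.+1) i)))) //.
by rewrite enum_ordSl /= foldl_rcons.
Qed.

(* Main.v *)
Require Import Defs.
From mathcomp Require Import all_boot all_order all_algebra.
From mathcomp Require Import interval_inference reals.
Import Order.TTheory GRing.Theory Num.Theory.
Local Open Scope ring_scope.

(** The two sides are separated by 0. By (b) each pair has a zero entry, and 0 annihilates any
    t-norm, so the left side is an iterated t-conorm of zeros, hence 0 ([tnorm_min0], [nary_ext0]).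
    By (a) some pair in column [j] has both entries in [0,1), so their distance is below 1 and the
    maximum on the right is positive. *)

Lemma tnorm0l (R : realType) (T : {i01 R} -> {i01 R} -> {i01 R}) (a : {i01 R}) :
  is_tnorm T -> T 0%:i01 a = 0%:i01.
Proof.
move=> hT; apply/le_anti/andP; split.
(* Monotonicity in the second argument: T(0,a) <= T(0,1) = 0. *)
- rewrite -{2}(tnorm1 hT 0%:i01); apply: (tnorm_homor hT).
  by rewrite -num_le /=.
- by rewrite -num_le /=.
Qed.

Lemma tnorm_min0 (R : realType) (T : {i01 R} -> {i01 R} -> {i01 R})
    (a b : {i01 R}) :
  is_tnorm T -> Num.min a%:num b%:num = 0 -> T a b = 0%:i01.
Proof.
move=> hT; rewrite minEle; case: ifP => _ h.
- have -> : a = 0%:i01 by apply/val_inj.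
  exact: tnorm0l.
- have -> : b = 0%:i01 by apply/val_inj.
  by rewrite (tnormC hT) tnorm0l.
Qed.

Lemma nary_ext0 (R : realType) (S : {i01 R} -> {i01 R} -> {i01 R}) (n : nat)
    (c : 'I_n -> {i01 R}) :
  is_tconorm S -> (forall i, c i = 0%:i01) -> nary_ext S c = 0%:i01.
Proof.
move=> hS c0; rewrite /nary_ext.
(* The empty case is the default value 0; otherwise the fold starts at 0 and S(0,0) = 0 keeps it
   there. *)
case: (enum 'I_n) => [//|i s] /=; rewrite c0.
by elim: s => [//|k s IH] /=; rewrite c0 (tconorm0 hS).
Qed.

Theorem corollary2 (R : realType) (n m : nat) (n_gt0 : (0 < n)%N)
    (m_gt0 : (0 < m)%N) (A : 'M[{i01 R}]_(n, m)) (x : 'rV[{i01 R}]_n)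
    (j : 'I_m)
    (ha : forall j' : 'I_m, exists i : 'I_n,
      Num.max (x ord0 i)%:num (A i j')%:num < 1)
    (hb : forall i : 'I_n, Num.min (x ord0 i)%:num (A i j)%:num = 0) :
  forall T S : {i01 R} -> {i01 R} -> {i01 R}, is_tnorm T -> is_tconorm S ->
  (nary_ext S (fun i : 'I_n => T (x ord0 i) (A i j)))%:num
  < \big[Num.max/0]_(i < n) (1 - `|(x ord0 i)%:num - (A i j)%:num|).
Proof.
move=> T S hT hS.
rewrite (nary_ext0 _ _ _ _ hS) => [|i]; last first.
  exact: (tnorm_min0 _ _ _ _ hT (hb i)).
(* Condition (a) is taken at the column [j] itself. *)
have [i] := ha j; rewrite gt_max => /andP[x1 a1].
have h : `|(x ord0 i)%:num - (A i j)%:num| < 1.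
  rewrite ltr_norml ltrBrDr ltrBlDr; apply/andP; split.
    by rewrite addrC ltrBlDr (lt_le_trans a1) // lerDr.
  by rewrite (lt_le_trans x1) // lerDl.
(* The single term at [i] already makes the maximum positive. *)
by rewrite (bigD1 i) //= lt_max subr_gt0 h.
Qed.
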